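(* Let $G$ be a connected graph that contains neither $C_3$ nor $C_4$ as a subgraph. Then the distance matrix $D(G)$ has exactly three distinct eigenvalues $\lambda_1(D(G))>\lambda_2(D(G))>\lambda_3(D(G))$ and these satisfy $\lambda_3(D(G))=-3$ if and only if $G$ is the Petersen graph.
   Context: Graphs are finite and simple. For a connected graph $G$ with vertices $v_1,\ldots,v_n$, the distance $d_{i,j}$ between $v_i$ and $v_j$ is the length of a shortest path from $v_i$ to $v_j$, and the distance matrix $D(G)$ is the $n\times n$ real symmetric matrix whose $(i,j)$-entry is $d_{i,j}$. $C_k$ denotes the cycle on $k$ vertices. *)

(* Defs.v *)
From HB Require Import structures.
From mathcomp Require Import all_boot all_order all_algebra.
From mathcomp Require Import reals.

Set Implicit Arguments.
Unset Strict Implicit.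
Unset Printing Implicit Defensive.

Import Order.TTheory GRing.Theory Num.Theory.

Local Open Scope ring_scope.

(* A finite simple graph is a relation [e] on a finType with
   [symmetric e] and [irreflexive e]. *)

Definition connected_graph (T : finType) (e : rel T) : Prop :=
  forall x y : T, connect e x y.

(* The vertices of the path are [x :: p]; its length is [size p]. *)
Definition graph_path (T : finType) (e : rel T) (x y : T) (p : seq T) : bool :=
  [&& path e x p, last x p == y & uniq (x :: p)].

(* Least length of a path from [x] to [y].  A path has fewer than [#|T|]
   edges, so the search range is sufficient; the value is [#|T|] when no path
   exists. *)
Definition graph_dist (T : finType) (e : rel T) (x y : T) : nat :=
  find (fun m => [exists p : m.-tuple T, graph_path e x y p]) (iota 0 #|T|).

Definition distance_matrix (R : realType) (n : nat) (e : rel 'I_n) : 'M[R]_n :=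
  \matrix_(i < n, j < n) (graph_dist e i j)%:R.

(* Not necessarily induced. *)
Definition contains_subgraph (S T : finType) (h : rel S) (e : rel T) : Prop :=
  exists2 f : S -> T, injective f & forall x y, h x y -> e (f x) (f y).

Definition graph_iso (S T : finType) (h : rel S) (e : rel T) : Prop :=
  exists2 f : S -> T, bijective f & forall x y, e (f x) (f y) = h x y.

(* A simple graph for [k >= 3] only. *)
Definition cycle_graph (k : nat) : rel 'I_k :=
  fun i j => (j == i.+1 %% k :> nat)%N || (i == j.+1 %% k :> nat)%N.

(* The Petersen graph as the Kneser graph KG(5,2). *)
Definition petersen_vertex : finType := {A : {set 'I_5} | #|A| == 2}.

Definition petersen : rel petersen_vertex :=
  fun A B => [disjoint val A & val B].

(* The last condition says that [l1], [l2], [l3] are all the eigenvalues. *)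
Definition three_distinct_eigenvalues (R : realType) (n : nat) (A : 'M[R]_n)
    (l1 l2 l3 : R) : Prop :=
  [/\ l2 < l1, l3 < l2 &
      forall a : R, eigenvalue A a = (a \in [:: l1; l2; l3])].

(* Main.v *)
Require Import Defs.
From mathcomp Require Import all_boot all_order all_algebra.
From mathcomp Require Import reals.
From mathcomp Require Import complex lra ring.

(** If [G] has diameter at most 2 its distance matrix is [D = 2J - 2I - A],
    with [A] the adjacency matrix and [J] the all-ones matrix, so the spectrum
    of [D] can be read off that of [A].  If moreover [G] has no triangle and no
    4-cycle, two distinct vertices have exactly one common neighbour or none,
    according as they are non-adjacent or adjacent, whence
    [A^2 = diag(deg) + J - I - A] ([adjacency_sqr]).

    From the spectrum to the graph.  A symmetric matrix with least eigenvalue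
    [-3] satisfies [-3 <w, w> <= <w, M w>], and so do its principal submatrices
    ([quadratic_form_mxsub_ge]).  The distance matrix of a path on four
    vertices violates this at [w = (2, 1, -1, -2)], so no such path is
    isometrically embedded in [G], and [G] has diameter at most 2
    ([diameter_le2_of_eigenvalue_ge]).  Comparing [A A^2] with [A^2 A], entry by
    entry, shows that non-adjacent vertices have the same degree; from this
    [G] is regular or has a vertex adjacent to all the others
    ([regular_or_star]).  In the second case [G] is a star, and [-3] is not an
    eigenvalue of [D] ([star_not_eigenvalue]).  If [G] is [k]-regular, an
    eigenvector of [D] for [-3] is orthogonal to the all-ones vector, hence an
    eigenvector of [A] for [1], and the equation for [A^2] gives [k = 3]
    ([regular_degree3]).

    A cubic graph of diameter 2 without triangles and 4-cycles is the Petersen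
    graph: starting from one vertex, its vertices can be named by the
    2-subsets of a 5-element set so that disjoint subsets are adjacent
    ([petersen_labelling]).  Absence of triangles makes such a naming
    injective, and since both graphs are cubic and [G] is connected it is an
    isomorphism ([petersen_of_labelling]).

    From the graph to the spectrum.  The Petersen graph is cubic of diameter 2,
    so [(A - I)(A + 2I) = J].  On the vectors of sum zero, [D] therefore has
    only the eigenvalues [-3] and [0], and both occur; the all-ones vector
    gives [2n - 5] ([cubic_eigenvalueE]). *)

Set Implicit Arguments.
Unset Strict Implicit.
Unset Printing Implicit Defensive.

Import Order.TTheory GRing.Theory Num.Theory.

Local Open Scope ring_scope.

(** * Least eigenvalue and quadratic form *)

(** A unitary matrix over [R[i]] diagonalises [A].  The diagonal entries are
    real, hence eigenvalues of [A] over [R], and the quadratic form is their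
    sum weighted by the squared moduli of the coordinates of [w] in the
    corresponding basis. *)
Lemma quadratic_form_ge_eigenvalue (R : rcfType) n (A : 'M[R]_n) (c : R) :
  A \is symmetricmx -> (forall a, eigenvalue A a -> c <= a) ->
  forall w : 'rV_n, c * (w *m w^T) 0 0 <= (w *m A *m w^T) 0 0.
Proof.
move=> Asym cP w; pose toC : {rmorphism R -> R[i]} := real_complex R.
pose AC := map_mx toC A; pose wC := map_mx toC w.
have toC_real x : toC x \is Num.real by rewrite complex_real eqxx.
have AC_herm : AC \is hermsymmx.
  apply: realsym_hermsym; last by apply/mxOverP => i j; rewrite mxE toC_real.
  apply/is_hermitianmxP; rewrite expr0 scale1r map_mx_id // /AC map_trmx.
  by move/is_hermitianmxP: Asym; rewrite expr0 scale1r map_mx_id // => {1}->.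
have /orthomx_spectralP := hermitian_normalmx AC_herm.
have := hermitian_spectral_diag_real AC_herm.
have := spectral_unitarymx AC.
move: (spectralmx AC) (spectral_diag AC) => P d P_unit d_real AC_diag.
have d_ge i : toC c <= d 0 i.
  have /mxOverP /(_ 0 i) /complex_realP [a dE] := d_real.
  have : eigenvalue AC (toC a).
    apply/eigenvalueP; exists (row i P).
      rewrite AC_diag !mulmxA -row_mul mulmxV ?unitarymx_unit //.
      rewrite -!row_mul mul1mx.
      by apply/rowP => j; rewrite mul_diag_mx !mxE dE.
    apply/negP => /eqP Pi0.
    have /unitarymxP /(congr1 (row i)) := P_unit; rewrite row_mul Pi0 mul0mx.
    by move/rowP/(_ i); rewrite !mxE eqxx => /esym/eqP; rewrite oner_eq0.
  by rewrite eigenvalue_map => /cP ca; rewrite dE lecR.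
(* The coordinates of w in the orthonormal basis of eigenvectors. *)
pose u := wC *m (P ^t Num.conj)%sesqui.
have wCc : (wC ^t Num.conj)%sesqui = map_mx toC w^T.
  by apply/matrixP => i j; rewrite !mxE; apply/CrealP; rewrite toC_real.
have uc : (u ^t Num.conj)%sesqui = P *m map_mx toC w^T.
  rewrite -wCc /u trmx_mul map_mxM; congr (_ *m _).
  by rewrite trmxCK.
have PtP : (P ^t Num.conj)%sesqui *m P = 1%:M.
  by rewrite -invmx_unitary // mulVmx // unitarymx_unit.
have ww : toC ((w *m w^T) 0 0) = \sum_i `|u 0 i| ^+ 2.
  transitivity ((u *m (u ^t Num.conj)%sesqui) 0 0).
    rewrite uc /u -mulmxA (mulmxA _ P) PtP mul1mx -map_mxM.
    by rewrite [RHS]mxE.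
  by rewrite mxE; apply: eq_bigr => i _; rewrite !mxE normCK.
have wAw : toC ((w *m A *m w^T) 0 0) = \sum_i d 0 i * `|u 0 i| ^+ 2.
  transitivity ((u *m diag_mx d *m (u ^t Num.conj)%sesqui) 0 0).
    rewrite uc /u -invmx_unitary // !mulmxA -(mulmxA _ (invmx P)).
    rewrite -(mulmxA wC) -AC_diag -!map_mxM.
    by rewrite [RHS]mxE.
  rewrite mxE; apply: eq_bigr => i _.
  by rewrite mul_mx_diag !mxE normCK mulrAC mulrC.
rewrite -lecR -/(toC _) rmorphM /= ww wAw mulr_sumr.
by apply: ler_sum => i _; rewrite ler_wpM2r ?exprn_ge0.
Qed.

(** A vector on the selected indices, extended by zero, is a test vector for the
    whole matrix. *)
Lemma quadratic_form_mxsub_ge (R : rcfType) m n (A : 'M[R]_n) (c : R)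
    (f : 'I_m -> 'I_n) :
  A \is symmetricmx -> (forall a, eigenvalue A a -> c <= a) -> injective f ->
  forall w : 'rV_m, c * (w *m w^T) 0 0 <= (w *m mxsub f f A *m w^T) 0 0.
Proof.
move=> Asym cP f_inj w; pose S : 'M[R]_(m, n) := rowsub f 1%:M.
have := quadratic_form_ge_eigenvalue Asym cP (w *m S).
have ST : S^T = colsub f 1%:M by rewrite trmx_mxsub trmx1.
have SS : S *m S^T = 1%:M.
  rewrite ST mulmx_colsub mulmx1; apply/matrixP => i j.
  by rewrite !mxE (inj_eq f_inj).
have SAS : S *m A *m S^T = mxsub f f A.
  rewrite ST mulmx_colsub mulmx1 mul_rowsub_mx mul1mx.
  by apply/matrixP => i j; rewrite !mxE.
rewrite trmx_mul !mulmxA -[in X in X <= _ -> _](mulmxA w) SS mulmx1.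
by rewrite -2![in X in _ <= X -> _](mulmxA w) SAS.
Qed.

Lemma eigenvalue_size_gt0 (F : fieldType) n (A : 'M[F]_n) a :
  eigenvalue A a -> (0 < n)%N.
Proof.
by case: n A => // A /eigenvalueP[v _ /eqP[]]; exact: thinmx0.
Qed.

(** * Forbidden cycles and distances *)

Definition triangle_free (T : finType) (e : rel T) :=
  forall x y z, e x y -> e y z -> e x z -> False.

Definition square_free (T : finType) (e : rel T) :=
  forall x y z w, x != y -> e x z -> e z y -> e x w -> e w y -> z = w.

Definition diameter_le2 (T : finType) (e : rel T) :=
  forall x y, x != y -> ~~ e x y -> exists2 z, e x z & e z y.

Section Distance.

Variables (T : finType) (e : rel T).
Hypotheses (e_sym : symmetric e) (e_irr : irreflexive e).

Lemma adj_neq x y : e x y -> x != y.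
Proof. by apply: contraTneq => ->; rewrite e_irr. Qed.

Lemma not_contains_cycle3 :
  ~ contains_subgraph (@cycle_graph 3) e -> triangle_free e.
Proof.
move=> noC3 x y z xy yz xz; apply: noC3.
have xyz_uniq : uniq [:: x; y; z] by rewrite /= !inE negb_or !adj_neq.
exists (tnth [tuple x; y; z]); first by apply/tuple_uniqP.
move=> [[|[|[|//]]] i_lt] [[|[|[|//]]] j_lt] //= _; rewrite !(tnth_nth x) //=;
  by rewrite e_sym.
Qed.

Lemma not_contains_cycle4 :
  ~ contains_subgraph (@cycle_graph 4) e -> square_free e.
Proof.
move=> noC4 x y z w xy xz zy xw wy.
apply/eqP/negPn/negP => zw; apply: noC4.
have xzyw_uniq : uniq [:: x; z; y; w].
  rewrite /= !inE !negb_or xy zw !adj_neq //.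
  by rewrite e_sym.
exists (tnth [tuple x; z; y; w]); first by apply/tuple_uniqP.
move=> [[|[|[|[|//]]]] i_lt] [[|[|[|[|//]]]] j_lt] //= _;
  by rewrite !(tnth_nth x) //= e_sym.
Qed.

(** The bounded search in [graph_dist] reaches the length of a path, because a
    path has no repeated vertex. *)
Lemma graph_dist_eq x y p : graph_path e x y p ->
  (forall q, graph_path e x y q -> size p <= size q)%N ->
  graph_dist e x y = size p.
Proof.
move=> xyp p_min; rewrite /graph_dist; set a := fun m => _.
have p_lt : (size p < #|T|)%N.
  by have /and3P[_ _ /card_uniqP /= xp] := xyp; rewrite -xp; exact: max_card.
have ap : a (size p) by apply/existsP; exists (in_tuple p).
have [lt_p|lt_p|//] := ltngtP (find a (iota 0 #|T|)) (size p).
- have /(nth_find 0%N) : has a (iota 0 #|T|).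
    by rewrite has_find size_iota (ltn_trans lt_p).
  rewrite nth_iota ?(ltn_trans lt_p) // add0n => /existsP[q /p_min].
  by rewrite size_tuple leqNgt lt_p.
- have := before_find 0%N lt_p.
  by rewrite nth_iota // add0n ap.
Qed.

Lemma graph_dist_refl x : graph_dist e x x = 0%N.
Proof.
by apply: (@graph_dist_eq x x [::]) => //; rewrite /graph_path /= eqxx.
Qed.

Lemma graph_dist_adj x y : e x y -> graph_dist e x y = 1%N.
Proof.
move=> xy; apply: (@graph_dist_eq x y [:: y]).
  by rewrite /graph_path /= xy eqxx inE adj_neq.
by case=> // /and3P[_ /eqP/= x_y _]; rewrite x_y e_irr in xy.
Qed.

Lemma graph_dist_2 x y z : x != y -> ~~ e x y -> e x z -> e z y ->
  graph_dist e x y = 2%N.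
Proof.
move=> x_y xy xz zy; apply: (@graph_dist_eq x y [:: z; y]).
  by rewrite /graph_path /= xz zy eqxx !inE negb_or x_y !adj_neq.
case=> [|a [|b q]] //; rewrite /graph_path /= ?andbT.
  by rewrite (negPf x_y).
by case/and3P=> xa /eqP ay; rewrite -ay xa in xy.
Qed.

Lemma graph_dist_3 x y z w : x != y -> ~~ e x y ->
  (forall v, e x v -> e v y -> False) -> e x z -> e z w -> e w y ->
  graph_dist e x y = 3%N.
Proof.
move=> x_y xy no_v xz zw wy; apply: (@graph_dist_eq x y [:: z; w; y]).
  have x_w : x != w by apply: contraNneq xy => ->.
  have z_y : z != y by apply: contraNneq xy => <-.
  by rewrite /graph_path /= xz zw wy eqxx !inE !negb_or x_y x_w z_y !adj_neq.
case=> [|a [|b [|c q]]] //; rewrite /graph_path /= ?andbT.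
- by rewrite (negPf x_y).
- by case/and3P=> xa /eqP ay; rewrite -ay xa in xy.
- by case/and3P=> /andP[xa ab] /eqP b_y _; case: (no_v a); rewrite -?b_y.
Qed.

(** If some vertex is far from [x], then by connectedness some edge [u w] leaves
    the ball of radius 2 around [x]; a shortest path from [x] to [u] followed
    by this edge is isometric. *)
Lemma diameter_le2_or_path4 : connected_graph e ->
  diameter_le2 e \/
  exists x0 x1 x2 x3,
    [/\ graph_dist e x0 x1 = 1, graph_dist e x1 x2 = 1
       & graph_dist e x2 x3 = 1]%N
    /\ [/\ graph_dist e x0 x2 = 2, graph_dist e x1 x3 = 2
       & graph_dist e x0 x3 = 3]%N.
Proof.
move=> e_conn.
pose near x := [pred y | [|| x == y, e x y | [exists z, e x z && e z y]]].
case: (boolP [forall x, forall y, y \in near x]) => [all_near|].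
  left=> x y x_y xy; have /forallP/(_ x)/forallP/(_ y) := all_near.
  by rewrite inE (negPf x_y) (negPf xy) => /existsP[z /andP[]]; exists z.
rewrite negb_forall => /existsP[x]; rewrite negb_forall => /existsP[y far_y].
right; case: (boolP [forall u, forall w, e u w ==> (u \in near x) ==>
                                          (w \in near x)]) => [near_closed|].
  have /closed_connect/(_ x y (e_conn x y)) : closed e (near x).
    apply: intro_closed; first exact: sym_connect_sym.
    move=> u w uw; have /forallP/(_ u)/forallP/(_ w) := near_closed.
    rewrite uw implyTb => /implyP uw_near near_u; exact: uw_near.
  by rewrite (negPf far_y) !inE eqxx.
rewrite negb_forall => /existsP[u]; rewrite negb_forall => /existsP[w].
rewrite !negb_imply => /and3P[uw near_u far_w].
have {far_w} : [/\ x != w, ~~ e x w & forall z, e x z -> e z w -> False].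
  move: far_w; rewrite !inE !negb_or => /and3P[-> -> far_w]; split=> // z xz zw.
  by case/negP: far_w; apply/existsP; exists z; rewrite xz.
case=> x_w xw far_w.
move: near_u; rewrite inE => /or3P[/eqP x_u|xu|].
- by rewrite x_u uw in xw.
- by case: (far_w u).
case/existsP=> z /andP[xz zu]; exists x, z, u, w.
have x_u : x != u by apply: contraNneq xw => ->.
have xu : ~~ e x u by apply/negP => xu; apply: (far_w u).
have z_w : z != w by apply: contraNneq xw => <-.
have zw : ~~ e z w by apply/negP => zw; apply: (far_w z).
split; split.
- exact: graph_dist_adj.
- exact: graph_dist_adj.
- exact: graph_dist_adj.
- exact: graph_dist_2 xz zu.
- exact: graph_dist_2 zu uw.
- exact: graph_dist_3 xz zu uw.
Qed.

End Distance.

Lemma graph_distC (T : finType) (e : rel T) x y : symmetric e ->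
  graph_dist e x y = graph_dist e y x.
Proof.
move=> e_sym.
have rev_graph_path u v p : graph_path e u v p ->
    graph_path e v u (rev (belast u p)).
  case/and3P=> up /eqP uv p_uniq; apply/and3P; split.
  - by rewrite -uv rev_path; under eq_path => a b do rewrite e_sym.
  - case: p uv {up p_uniq} => [/= ->|z p _] //=.
    by rewrite rev_cons last_rcons.
  - by rewrite -rev_rcons rev_uniq -uv -lastI.
apply: eq_find => m; apply/existsP/existsP => -[p] /rev_graph_path p_rev.
  have p_size : size (rev (belast x p)) == m.
    by rewrite size_rev size_belast size_tuple.
  by exists (Tuple p_size).
have p_size : size (rev (belast y p)) == m.
  by rewrite size_rev size_belast size_tuple.
by exists (Tuple p_size).
Qed.

(** The least eigenvalue of the distance matrix of a path on four vertices is
    about [-3.41], so such a path cannot be isometrically embedded. *)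
Lemma diameter_le2_of_eigenvalue_ge (R : realType) n (e : rel 'I_n) :
  symmetric e -> irreflexive e -> connected_graph e ->
  (forall a : R, eigenvalue (distance_matrix R e) a -> -3 <= a) ->
  diameter_le2 e.
Proof.
move=> e_sym e_irr e_conn.
set D := distance_matrix R e => D_ge.
have Dsym : D \is symmetricmx.
  apply/is_hermitianmxP; rewrite expr0 scale1r map_mx_id //.
  by apply/matrixP => i j; rewrite !mxE graph_distC.
case: (diameter_le2_or_path4 e_sym e_irr e_conn) => //.
case=> x0 [x1 [x2 [x3 [[d01 d12 d23] [d02 d13 d03]]]]].
pose x := [tuple x0; x1; x2; x3].
(* The distance |i - j|, written with truncated subtractions. *)
have x_dist (i j : 'I_4) :
    graph_dist e (tnth x i) (tnth x j) = (i - j + (j - i))%N.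
  wlog ij : i j / (i <= j)%N => [wlog_ij|].
    by case/orP: (leq_total i j) => /wlog_ij //; rewrite graph_distC // addnC.
  case: i j ij => [[|[|[|[|//]]]] i_lt] [[|[|[|[|//]]]] j_lt] //= _;
  by rewrite !(tnth_nth x0) //= graph_dist_refl.
have x_inj : injective (tnth x).
  move=> i j xij; apply/val_inj/eqP; rewrite eqn_leq -!subn_eq0 -addn_eq0.
  by rewrite -x_dist xij graph_dist_refl.
(* An approximate eigenvector for the least eigenvalue: the quadratic form
   takes the value -34 at w, while the squared norm of w is 10. *)
pose w : 'rV[R]_4 := \row_i nth 0 [:: 2; 1; -1; -2] i.
have := quadratic_form_mxsub_ge Dsym D_ge x_inj w.
rewrite !mxE !big_ord_recl !big_ord0 !mxE.
rewrite !big_ord_recl !big_ord0 !mxE !x_dist /= /bump /=.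
rewrite !(addn0, add0n, add1n, subSS, sub0n, subn0, subnn).
rewrite leNgt => /negP[]; clear; lra.
Qed.

(** * The distance matrix in diameter two *)

Section Algebra.

Variables (R : realType) (n : nat) (e : rel 'I_n).
Hypotheses (e_sym : symmetric e) (e_irr : irreflexive e).
Hypotheses (e_tri : triangle_free e) (e_sq : square_free e).
Hypothesis e_diam : diameter_le2 e.

Let A : 'M[R]_n := \matrix_(i, j) (e i j)%:R.
Let J : 'M[R]_n := const_mx 1.
Let D : 'M[R]_n := distance_matrix R e.

Lemma distance_matrixE : D = 2 *: J - 2%:M - A.
Proof.
apply/matrixP => i j; rewrite !mxE.
have [->|i_j] := eqVneq i j; first by rewrite graph_dist_refl e_irr /=; ring.
case: (boolP (e i j)) => [ij|nij].
  by rewrite graph_dist_adj //=; ring.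
have [z iz zj] := e_diam i_j nij.
by rewrite (graph_dist_2 e_irr i_j nij iz zj) /=; ring.
Qed.

Lemma deg_sum i : #|e i|%:R = \sum_j (e i j)%:R :> R.
Proof.
rewrite -sum1_card natr_sum big_mkcond; apply: eq_bigr => j _.
by rewrite unfold_in; case: (e i j).
Qed.

(** The entries of the square count common neighbours: the degree on the
    diagonal, none for adjacent vertices, one for the other pairs. *)
Lemma adjacency_sqr :
  A *m A = diag_mx (\row_i #|e i|%:R) + J - 1%:M - A.
Proof.
apply/matrixP => i j; rewrite !mxE.
under eq_bigr => k _ do rewrite !mxE -natrM mulnb.
have [<-|i_j] := eqVneq i j.
  rewrite e_irr deg_sum mulr1n addrK subr0; apply: eq_bigr => k _.
  by rewrite (e_sym k) andbb.
case: (boolP (e i j)) => [ij|nij].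
  rewrite big1 => [|k _]; first by rewrite /=; ring.
  by case: andP => // -[ik kj]; case: (e_tri ik kj ij).
have [z iz zj] := e_diam i_j nij.
rewrite (bigD1 z) //= iz zj big1 => [|k k_z]; first by rewrite /=; ring.
case: andP => // -[ik kj]; case/eqP: k_z.
exact: e_sq i_j ik kj iz zj.
Qed.

(** The entries at [(i, j)] of [A (A A)] and [(A A) A], computed with
    [adjacency_sqr], differ by [#|e i| - #|e j|] when [i] and [j] are not
    adjacent. *)
Lemma nonadj_deg i j : i != j -> ~~ e i j -> #|e i| = #|e j|.
Proof.
move=> i_j nij.
have /matrixP/(_ i j) := mulmxA A A A.
rewrite adjacency_sqr !(mulmxDl, mulmxDr, mulNmx, mulmxN, mul1mx, mulmx1).
rewrite mul_diag_mx mul_mx_diag !mxE (negPf nij) mulr0 mul0r.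
have -> : \sum_k A i k * J k j = #|e i|%:R.
  by rewrite deg_sum; apply: eq_bigr => k _; rewrite !mxE mulr1.
have -> : \sum_k J i k * A k j = #|e j|%:R.
  by rewrite deg_sum; apply: eq_bigr => k _; rewrite !mxE mul1r e_sym.
by move=> /addIr /addIr /addrI /eqP; rewrite eqr_nat => /eqP.
Qed.

(** Let [x] and [y] have different degrees; they are adjacent by [nonadj_deg].
    If neither is adjacent to all other vertices, choose [w] not adjacent to
    [x] and [z] not adjacent to [y].  Then [w] has the degree of [x] and [z]
    that of [y], so [y w], [x z] and [w z] are edges, and they form a 4-cycle
    with [x y]. *)
Lemma regular_or_star :
  (exists k, forall i, #|e i| = k) \/ (exists c, forall i, i != c -> e c i).
Proof.
case: (boolP [forall i, forall j, #|e i| == #|e j|]) => [all_eq|].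
  left; case: (pickP 'I_n) => [i0 _|noi]; last first.
    by exists 0%N => i; have := noi i.
  exists #|e i0| => i; apply/eqP.
  by have /forallP/(_ i)/forallP/(_ i0) := all_eq.
rewrite negb_forall => /existsP[x]; rewrite negb_forall => /existsP[y deg_xy].
right.
have x_y : x != y by apply: contraNneq deg_xy => ->.
have xy : e x y by apply: contraNT deg_xy => /(nonadj_deg x_y) ->.
case: (boolP [forall i, (i != x) ==> e x i]) => [/forallP x_all|].
  by exists x => i; apply/implyP.
rewrite negb_forall => /existsP[w]; rewrite negb_imply => /andP[w_x xw].
exists y => z z_y; apply: contraT => yz.
have z_x : z != x by apply: contraNneq yz => ->; rewrite e_sym.
have w_y : w != y by apply: contraNneq xw => ->.
have deg_w : #|e x| = #|e w| by apply: nonadj_deg; rewrite // eq_sym.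
have deg_z : #|e y| = #|e z| by apply: nonadj_deg; rewrite // eq_sym.
have yw : e y w.
  apply: contraNT deg_xy => yw; rewrite deg_w eq_sym; apply/eqP.
  by apply: nonadj_deg; rewrite // eq_sym.
have xz : e x z.
  apply: contraNT deg_xy => xz; rewrite deg_z; apply/eqP.
  by apply: nonadj_deg; rewrite // eq_sym.
have wz : e w z.
  have w_z : w != z by apply: contraNneq yz => <-.
  by apply: contraNT deg_xy => /(nonadj_deg w_z); rewrite -deg_w -deg_z => ->.
have x_w : x != w by rewrite eq_sym.
by rewrite (e_sq x_w xy yw xz) ?eqxx // e_sym in z_y.
Qed.

Lemma mul_const_mx1 (v : 'rV[R]_n) : v *m J = const_mx (\sum_i v 0 i).
Proof.
by apply/rowP => i; rewrite !mxE; apply: eq_bigr => j _; rewrite !mxE mulr1.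
Qed.

Lemma eigenvector_adjacency (v : 'rV[R]_n) a : v *m D = a *: v ->
  v *m A = const_mx (2 * \sum_i v 0 i) - (2 + a) *: v.
Proof.
rewrite distance_matrixE !mulmxBr -scalemxAr mul_mx_scalar mul_const_mx1.
move=> /rowP vD; apply/rowP => i; move: (vD i); rewrite !mxE; lra.
Qed.

(** For an eigenvector [v] with sum [s], the equation at a leaf gives the value
    [v c - 2 s] there, and the equation at the centre [c] gives [s = - 2 v c].
    So every leaf has value [5 v c], and adding up the [m] leaves,
    [(3 + 5 m) v c = 0]. *)
Lemma star_not_eigenvalue c : (forall i, i != c -> e c i) ->
  ~~ eigenvalue D (-3).
Proof.
move=> c_star; apply/eigenvalueP => -[v /eigenvector_adjacency vA /eqP v_neq0].
apply: v_neq0; set s := \sum_i v 0 i in vA.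
have v_leaf i : i != c -> v 0 i = v 0 c - 2 * s.
  move=> i_c; have /rowP/(_ i) := vA; rewrite !mxE (bigD1 c) //= !mxE c_star //.
  rewrite big1 => [|j j_c]; first by rewrite /=; lra.
  rewrite mxE; case: (boolP (e j i)) => ji; rewrite ?mulr0 //.
  by case: (e_tri (c_star j j_c) ji (c_star i i_c)).
have s_split : s = v 0 c + \sum_(i | i != c) v 0 i by rewrite /s (bigD1 c).
have s_c : s = -2 * v 0 c.
  have /rowP/(_ c) := vA; rewrite !mxE (bigD1 c) //= !mxE e_irr.
  rewrite (_ : \sum_(i | i != c) _ = s - v 0 c); first by rewrite /=; lra.
  rewrite s_split addrAC subrr add0r; apply: eq_bigr => i i_c.
  by rewrite mxE e_sym c_star // mulr1.
have v_c : v 0 c = 0.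
  have v_leaf5 i : i != c -> v 0 i = 5 * v 0 c.
    by move/v_leaf->; rewrite s_c; ring.
  move: s_split; rewrite (eq_bigr (fun=> 5 * v 0 c)) //.
  rewrite sumr_const s_c -mulr_natr => v_c0; apply/eqP.
  move: #|_| v_c0 => m v_c0.
  have m_ge0 : 0 <= m%:R :> R by [].
  have : (3 + 5 * m%:R) * v 0 c = 0 by lra.
  by move/eqP; rewrite mulf_eq0 => /orP[/eqP|//]; lra.
apply/rowP => i; rewrite mxE; have [->//|/v_leaf ->] := eqVneq i c.
by rewrite s_c v_c; ring.
Qed.

Section Regular.

Variable k : nat.
Hypothesis e_reg : forall i, #|e i| = k.

Lemma regular_adjacency_sqr : A *m A = k%:R%:M + J - 1%:M - A.
Proof.
rewrite adjacency_sqr; congr (_ + _ - _ - _).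
by apply/matrixP => i j; rewrite !mxE e_reg.
Qed.

Lemma regular_sum (v : 'rV[R]_n) :
  \sum_i (v *m A) 0 i = k%:R * \sum_i v 0 i.
Proof.
under eq_bigr => i _ do rewrite mxE.
rewrite exchange_big mulr_sumr; apply: eq_bigr => j _ /=.
rewrite -mulr_sumr mulrC; congr (_ * _).
by rewrite -(e_reg j) deg_sum; apply: eq_bigr => i _; rewrite mxE.
Qed.

(** The all-ones vector is an eigenvector of [D] for [2 n - 2 - k], and an
    eigenvector for another eigenvalue is orthogonal to it. *)
Lemma eigenvector_sum (v : 'rV[R]_n) a : v *m D = a *: v ->
  (2 * n%:R - 2 - k%:R - a) * \sum_i v 0 i = 0.
Proof.
move=> /eigenvector_adjacency vA; have := regular_sum v.
rewrite vA; under eq_bigr => i _ do rewrite !mxE.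
rewrite sumrB -!mulr_sumr sumr_const card_ord -[_ *+ n]mulr_natr; lra.
Qed.

(** On vectors of sum zero [A] acts as [- (2 + a)] and
    [A^2 + A - (k - 1) I] vanishes. *)
Lemma eigenvector_sqr (v : 'rV[R]_n) a : v *m D = a *: v ->
  \sum_i v 0 i = 0 -> (a ^+ 2 + 3 * a + 3 - k%:R) *: v = 0.
Proof.
move=> /eigenvector_adjacency vA s0; rewrite s0 mulr0 in vA.
have {}vA : v *m A = - (2 + a) *: v.
  by rewrite vA; apply/rowP => i; rewrite !mxE; ring.
have vJ : v *m J = 0 by rewrite mul_const_mx1 s0; apply/rowP => i; rewrite !mxE.
have := congr1 (mulmx v) regular_adjacency_sqr.
rewrite mulmxA vA -scalemxAl vA !mulmxBr mulmxDr mulmx1 mul_mx_scalar vJ vA.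
move=> /rowP vAA; apply/rowP => i; move: (vAA i); rewrite !mxE; lra.
Qed.

(** As [k <= n], the eigenvalue [2 n - 2 - k] of the all-ones vector is not
    [-3]. *)
Lemma regular_degree3 : eigenvalue D (-3) -> k = 3%N.
Proof.
move=> eig3; have n_gt0 := eigenvalue_size_gt0 eig3.
have /eigenvalueP[v vD v_neq0] := eig3.
have k_le_n : k%:R <= n%:R :> R.
  by rewrite ler_nat -(e_reg (Ordinal n_gt0)) -[leqRHS]card_ord max_card.
have s0 : \sum_i v 0 i = 0.
  have /eqP := eigenvector_sum vD; rewrite mulf_eq0 => /orP[/eqP a0|/eqP //].
  by have : 0 <= n%:R :> R by []; lra.
have /eqP := eigenvector_sqr vD s0.
rewrite scaler_eq0 (negPf v_neq0) orbF => /eqP k3; apply/eqP.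
by rewrite -(eqr_nat R); apply/eqP; lra.
Qed.

(** For a cubic graph [(A - I)(A + 2I) = J] annihilates the differences of two
    standard basis vectors; applying one factor to such a difference gives an
    eigenvector for the other factor.  Here [t] is [2] or [-1], and [A + t I]
    is the factor applied; the condition on [e j i] says that coordinate [i]
    of the result does not vanish. *)
Lemma cubic_eigenvalue_root (i j : 'I_n) (t : R) :
  k = 3%N -> i != j -> t ^+ 2 - t = 2 -> t != (e j i)%:R ->
  eigenvalue D (- 1 - t).
Proof.
move=> k3 i_j t_root t_ij.
pose y : 'rV[R]_n := delta_mx 0 i - delta_mx 0 j.
have sum_y : \sum_l y 0 l = 0.
  rewrite (bigD1 i) //= (bigD1 j) 1?eq_sym //= !mxE !eqxx (negPf i_j).
  rewrite eq_sym (negPf i_j) big1 => [|l /andP[li lj]].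
    by rewrite /=; ring.
  by rewrite !mxE (negPf li) (negPf lj) /= subr0.
have sumJ (w : 'rV[R]_n) : \sum_l w 0 l = 0 -> w *m J = 0.
  by move=> w0; rewrite mul_const_mx1 w0; apply/rowP => l; rewrite !mxE.
pose u := y *m A + t *: y.
have uA : u *m A = (t - 1) *: u.
  rewrite /u {u} mulmxDl -mulmxA regular_adjacency_sqr k3 !mulmxBr mulmxDr.
  rewrite mulmx1 mul_mx_scalar sumJ // -scalemxAl.
  clearbody y; move: (y *m A) => yA; apply/rowP => l; rewrite !mxE.
  set yl := y 0 l; have -> : (t - 1) * (yA 0 l + t * yl)
    = (t - 1) * yA 0 l + (t ^+ 2 - t) * yl by ring.
  by rewrite t_root; ring.
apply/eigenvalueP; exists u.
  rewrite distance_matrixE !mulmxBr -scalemxAr mul_mx_scalar uA sumJ.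
    by apply/rowP => l; rewrite !mxE; ring.
  under eq_bigr => l _ do rewrite mxE [X in _ + X]mxE.
  by rewrite big_split /= -mulr_sumr regular_sum sum_y !mulr0 addr0.
apply: contraNneq t_ij => /rowP/(_ i); rewrite /u /y mulmxBl -!rowE !mxE.
by rewrite !eqxx e_irr (negPf i_j) /= => u_i; apply/eqP; lra.
Qed.

Lemma cubic_eigenvalueE a : k = 3%N -> (0 < n)%N ->
  eigenvalue D a = (a \in [:: 2 * n%:R - 5; 0; -3]).
Proof.
move=> k3 n_gt0; apply/idP/idP.
  case/eigenvalueP=> v vD v_neq0; rewrite !inE.
  have /eqP := eigenvector_sum vD.
  rewrite k3 mulf_eq0 => /orP[/eqP a_n|/eqP s0].
    by apply/orP; left; apply/eqP; lra.
  have /eqP := eigenvector_sqr vD s0; rewrite scaler_eq0 (negPf v_neq0) orbF k3.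
  have -> : a ^+ 2 + 3 * a + 3 - 3%:R = a * (a + 3) by ring.
  by rewrite mulf_eq0 addr_eq0 => ->; rewrite orbT.
have [i [j ij]] : exists i j, e i j.
  pose i := Ordinal n_gt0; exists i.
  have /card_gt0P[j ij] : (0 < #|e i|)%N by rewrite e_reg k3.
  by exists j.
have i_j := adj_neq e_irr ij.
rewrite !inE => /or3P[] /eqP ->.
- apply/eigenvalueP; exists (const_mx 1).
    apply/rowP => l; rewrite distance_matrixE !mulmxBr -scalemxAr mul_mx_scalar.
    have oneA : ((const_mx 1 : 'rV[R]_n) *m A) 0 l = 3.
      rewrite -k3 -(e_reg l) deg_sum mxE; apply: eq_bigr => m _.
      by rewrite !mxE mul1r e_sym.
    have oneJ : ((const_mx 1 : 'rV[R]_n) *m J) 0 l = n%:R.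
      rewrite mxE; under eq_bigr => m _ do rewrite !mxE mulr1.
      by rewrite sumr_const card_ord.
    by move: oneA oneJ; rewrite !mxE => -> ->; ring.
  by apply/negP => /eqP/rowP/(_ i)/eqP; rewrite !mxE oner_eq0.
- have -> : 0 = -1 - (-1) :> R by ring.
  apply: (cubic_eigenvalue_root k3 i_j); first by ring.
  by rewrite eq_sym e_sym ij /=; apply/eqP; lra.
- have -> : -3 = -1 - 2 :> R by ring.
  apply: (cubic_eigenvalue_root k3 i_j); first by ring.
  by rewrite e_sym ij /=; apply/eqP; lra.
Qed.

End Regular.

End Algebra.

(** * Cubic graphs of diameter two and girth five *)

Section Labelling.

Variables (T : finType) (e : rel T).
Hypotheses (e_sym : symmetric e) (e_irr : irreflexive e).
Hypotheses (e_tri : triangle_free e) (e_sq : square_free e).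
Hypothesis e_diam : diameter_le2 e.
Hypothesis e_cubic : forall x, #|e x| = 3%N.

Lemma cubic_neighbours x y : e x y -> exists a b,
  uniq [:: y; a; b] /\ e x =i [:: y; a; b].
Proof.
move=> xy; have : y \in enum (e x) by rewrite mem_enum.
have size_x : size (enum (e x)) = 3%N by rewrite -cardE.
move/rot_to=> [i s] rot_y.
have : size (y :: s) = 3%N by rewrite -rot_y size_rot.
case: s rot_y => [|a [|b []]] // rot_y _; exists a, b; split.
  by rewrite -rot_y rot_uniq enum_uniq.
by move=> z; rewrite -rot_y mem_rot mem_enum.
Qed.

Lemma common_neighbour_nonadj x y z : e x y -> e x z -> ~~ e y z.
Proof. by move=> xy xz; apply/negP => yz; exact: e_tri xy yz xz. Qed.

(** The neighbours of [c] are [u], [v] and [w], and one of them is a common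
    neighbour of [y] and [c]. *)
Lemma cubic_last_neighbour c u v w y : e c u -> e c v -> e c w ->
  uniq [:: u; v; w] -> y != c -> ~~ e y c -> ~~ e y u -> ~~ e y v -> e y w.
Proof.
move=> cu cv cw uvw_uniq y_c yc yu yv.
have [z yz zc] := e_diam y_c yc.
have c_nb : [:: u; v; w] =i e c.
  apply/subset_cardP; first by rewrite (card_uniqP uvw_uniq) e_cubic.
  by apply/subsetP => t; rewrite !inE => /or3P[]/eqP->.
have : z \in [:: u; v; w] by rewrite c_nb unfold_in e_sym.
by rewrite !inE => /or3P[]/eqP z_eq; rewrite -?z_eq ?yz // in yu yv *.
Qed.

(** Here [u] and [v] are the neighbours of [a] other than [x], and [b1], [c1],
    [c2] are chosen as common neighbours of one of them with [b] or [c].  Such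
    choices leave open two sides of the hexagon on the vertices at distance 2
    from [x]; [b1 c2] is one of them, and exchanging [u] and [v] gives the
    other.  The vertex [b1] has a common neighbour with [c], whose neighbours are [x],
    [c1] and [c2]; the first would close a triangle with [b], the second a
    triangle with [u]. *)
Lemma petersen_closing_edge x a b c u v b1 c1 c2 :
  e x a -> e x b -> e x c -> b != c -> e a u -> e a v -> u != v ->
  e u b1 -> e b1 b -> e u c1 -> e c1 c -> e v c2 -> e c2 c -> e b1 c2.
Proof.
move=> xa xb xc b_c au av u_v ub1 b1b uc1 c1c vc2 c2c.
have ax : e a x by rewrite e_sym.
have bb1 : e b b1 by rewrite e_sym.
have cx : e c x by rewrite e_sym.
have cc1 : e c c1 by rewrite e_sym.
have cc2 : e c c2 by rewrite e_sym.
have ux : ~~ e u x by exact: common_neighbour_nonadj au ax.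
have vx : ~~ e v x by exact: common_neighbour_nonadj av ax.
have x_b1 : x != b1 by apply: contraNneq ux => ->.
have x_c1 : x != c1 by apply: contraNneq ux => ->.
have x_c2 : x != c2 by apply: contraNneq vx => ->.
have bx : e b x by rewrite e_sym.
have a_c1 : a != c1.
  by apply: contraTneq cc1 => <-; rewrite e_sym (common_neighbour_nonadj xa).
have c1_c2 : c1 != c2.
  apply: contra_neq u_v => c1_eq; apply: (e_sq a_c1 au uc1 av).
  by rewrite c1_eq.
apply: (cubic_last_neighbour cx cc1 cc2).
- by rewrite /= !inE negb_or x_c1 x_c2 c1_c2.
- apply: contraTneq b1b => ->; rewrite e_sym.
  exact: common_neighbour_nonadj xb xc.
- by apply: contra_neqN b_c => b1c; apply: (e_sq x_b1 xb bb1 xc); rewrite e_sym.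
- exact: common_neighbour_nonadj bb1 bx.
- exact: common_neighbour_nonadj ub1 uc1.
Qed.

(** A map [G] of this kind names the vertices by pairs of points so that
    disjoint pairs are adjacent.  The vertex [x] is named [{0, 1}] and its neighbours
    [a], [b], [c] are named [{2, 3}], [{2, 4}], [{3, 4}].  The other neighbours
    [a1], [a2] of [a] are [{0, 4}] and [{1, 4}]; the name of each of [b1],
    [b2], [c1], [c2] then follows from its two known neighbours, and the edges
    that are left come from [petersen_closing_edge]. *)
Lemma petersen_labelling (x : T) : exists G : 'I_5 -> 'I_5 -> T,
  (forall i j, G i j = G j i) /\
  (forall i j k l, uniq [:: i; j; k; l] -> e (G i j) (G k l)).
Proof.
have : (0 < #|e x|)%N by rewrite e_cubic.
case/card_gt0P=> a xa.
have [b [c [abc_uniq x_nb]]] := cubic_neighbours xa.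
move: abc_uniq; rewrite /= !inE negb_or andbT => /andP[/andP[ab ac] bc].
have {}xa : e x a := xa.
have xb : e x b by move: (x_nb b); rewrite !inE eqxx orbT.
have xc : e x c by move: (x_nb c); rewrite !inE eqxx !orbT.
have ax : e a x by rewrite e_sym.
have [a1 [a2 [a_uniq a_nb]]] := cubic_neighbours ax.
move: a_uniq; rewrite /= !inE negb_or andbT => /andP[/andP[x_a1 x_a2] a1_a2].
have aa1 : e a a1 by move: (a_nb a1); rewrite !inE eqxx orbT.
have aa2 : e a a2 by move: (a_nb a2); rewrite !inE eqxx !orbT.
have common u y : e a u -> x != u -> e x y -> a != y ->
    exists2 w, e u w & e w y.
  move=> au x_u xy a_y; apply: e_diam.
    by apply: contraTneq au => ->; apply/negP => ay; exact: (e_tri xa ay xy).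
  apply/negP => uy; case/eqP: a_y; apply: (e_sq x_u xa au xy); by rewrite e_sym.
have [b1 a1b1 b1b] := common _ _ aa1 x_a1 xb ab.
have [c1 a1c1 c1c] := common _ _ aa1 x_a1 xc ac.
have [b2 a2b2 b2b] := common _ _ aa2 x_a2 xb ab.
have [c2 a2c2 c2c] := common _ _ aa2 x_a2 xc ac.
have b1c2 : e b1 c2.
  exact: petersen_closing_edge xa xb xc bc aa1 aa2 a1_a2 a1b1 b1b a1c1 c1c
                               a2c2 c2c.
have b2c1 : e b2 c1.
  by apply: petersen_closing_edge xa xb xc bc aa2 aa1 _ a2b2 b2b a2c2 c2c
                                  a1c1 c1c; rewrite eq_sym.
(* Row i, column j is the vertex named {i, j}; the diagonal is arbitrary. *)
pose t := [:: [:: x; x; c2; b2; a1]; [:: x; x; c1; b1; a2];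
  [:: c2; c1; x; a; b]; [:: b2; b1; a; x; c]; [:: a1; a2; b; c; x]].
exists (fun i j => nth x (nth [::] t i) j); split.
  by move=> [[|[|[|[|[|//]]]]] ?] [[|[|[|[|[|//]]]]] ?].
move=> [[|[|[|[|[|//]]]]] ?] [[|[|[|[|[|//]]]]] ?] [[|[|[|[|[|//]]]]] ?];
  by move=> [[|[|[|[|[|//]]]]] ?] //= _; rewrite // e_sym.
Qed.

End Labelling.

(** * Isomorphisms and the Petersen graph *)

Lemma graph_iso_card (S T : finType) (h : rel S) (e : rel T) f :
  bijective f -> (forall x y, e (f x) (f y) = h x y) ->
  forall x, #|h x| = #|e (f x)|.
Proof.
case=> g fK gK f_adj x; rewrite -(card_image (can_inj fK) (h x)).
apply: eq_card => v; apply/imageP/idP => [[y xy ->]|xv].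
  by rewrite -topredE /= f_adj.
by exists (g v); rewrite ?gK // -topredE /= -f_adj gK.
Qed.

Lemma graph_iso_diameter_le2 (S T : finType) (h : rel S) (e : rel T) f :
  bijective f -> (forall x y, e (f x) (f y) = h x y) ->
  diameter_le2 e -> diameter_le2 h.
Proof.
case=> g fK gK f_adj e_diam x y x_y; rewrite -f_adj => nxy.
have f_x_y : f x != f y by rewrite (can_eq fK).
have [z xz zy] := e_diam _ _ f_x_y nxy.
by exists (g z); rewrite -f_adj gK.
Qed.

(** The image of a neighbourhood is contained in a neighbourhood of the same
    size, so it is all of it.  Hence [g] reflects adjacency and its image is a
    union of connected components. *)
Lemma regular_embedding_iso (S T : finType) (h : rel S) (e : rel T) k
    (g : S -> T) (x0 : S) :
  injective g -> (forall x y, h x y -> e (g x) (g y)) ->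
  (forall x, #|h x| = k) -> (forall y, #|e y| = k) ->
  symmetric e -> connected_graph e -> graph_iso e h.
Proof.
move=> g_inj g_hom h_reg e_reg e_sym e_conn.
have g_nb x : [seq g y | y in h x] =i e (g x).
  apply/subset_cardP; first by rewrite card_image // h_reg e_reg.
  by apply/subsetP => _ /imageP[y xy ->]; exact: g_hom.
have g_adj x y : e (g x) (g y) = h x y.
  by rewrite -[RHS]/(y \in h x) -(mem_image g_inj (h x)) g_nb.
have codom_closed : closed e (codom g).
  apply: intro_closed; first exact: sym_connect_sym.
  move=> u v uv /codomP[x u_x]; rewrite u_x in uv.
  have : v \in [seq g y | y in h x] by rewrite g_nb.
  by case/imageP=> y _ ->; exact: codom_f.
have g_onto y : y \in codom g.
  by rewrite -(closed_connect codom_closed (e_conn (g x0) y)) codom_f.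
have g_card : (#|T| <= #|S|)%N.
  by rewrite -(card_codom g_inj) subset_leq_card //; apply/subsetP.
have [f gK fK] := inj_card_bij g_inj g_card.
exists f; first by exists g.
by move=> u v; rewrite -g_adj !fK.
Qed.

Lemma petersen_vertex_inhabited : petersen_vertex.
Proof. by exists [set ord0; ord_max]; rewrite cards2. Qed.

Lemma petersen_cubic A : #|petersen A| = 3%N.
Proof.
have A2 : #|val A| = 2%N by apply/eqP; exact: (valP A).
have -> : 3%N = 'C(#|~: val A|, 2) by rewrite cardsCs setCK A2 card_ord.
rewrite -cards_draws -(card_imset _ val_inj); apply: eq_card => B.
rewrite inE -disjoints_subset disjoint_sym.
apply/imsetP/andP => [[C AC ->]|[AB B2]].
  by split; [exact: AC | exact: (valP C)].
by exists (Sub B B2) => //; rewrite unfold_in /petersen /=.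
Qed.

(** Two intersecting pairs of points cover at most three of the five points, and
    two others form a pair disjoint from both. *)
Lemma petersen_diameter : diameter_le2 petersen.
Proof.
move=> A B _ nAB.
have : (1 < #|~: (val A :|: val B)|)%N.
  rewrite cardsCs setCK card_ord cardsU (eqP (valP A)) (eqP (valP B)).
  have : (0 < #|val A :&: val B|)%N by rewrite card_gt0 setI_eq0.
  by case: #|_| => // [[|[|[|[]]]]].
case/card_gt1P=> i [j [i_AB j_AB i_j]].
have C2 : #|[set i; j]| == 2 by rewrite cards2 i_j.
move: i_AB j_AB; rewrite !inE !negb_or => /andP[i_A i_B] /andP[j_A j_B].
exists (Sub [set i; j] C2); rewrite /petersen /=.
  by rewrite disjoint_sym disjoints_subset subUset !sub1set !inE i_A.
by rewrite disjoints_subset subUset !sub1set !inE i_B.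
Qed.

(** The map that such a naming induces on the Petersen graph preserves edges.
    It is injective because any two distinct vertices of the Petersen graph are
    adjacent or joined by a path of length 3, the rest of a 5-cycle through
    them: were their images equal, there would be a loop or a triangle. *)
Lemma petersen_of_labelling (T : finType) (e : rel T) (G : 'I_5 -> 'I_5 -> T) :
  symmetric e -> irreflexive e -> triangle_free e -> connected_graph e ->
  (forall x, #|e x| = 3%N) -> (forall i j, G i j = G j i) ->
  (forall i j k l, uniq [:: i; j; k; l] -> e (G i j) (G k l)) ->
  graph_iso e petersen.
Proof.
move=> e_sym e_irr e_tri e_conn e_cubic GC G_adj.
have /fin_all_exists[g gE] (A : petersen_vertex) : exists v, exists i j,
    [/\ i != j, val A = [set i; j] & v = G i j].
  have /cards2P[i [j [i_j A_ij]]] := valP A.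
  by exists (G i j), i, j.
have G_inj_r i j l : i != j -> i != l -> G i j = G i l -> j = l.
  move=> i_j i_l G_eq; apply/eqP/negPn/negP => j_l.
  have : (1 < #|~: [set i; j; l]|)%N.
    rewrite cardsCs setCK card_ord -setUA cardsU1 cards2 !inE negb_or.
    by rewrite i_j i_l j_l.
  (* With m and p the other points, {i,j}, {l,m}, {j,p}, {i,l} is a path. *)
  case/card_gt1P=> m [p []]; rewrite !inE !negb_or.
  case/andP=> /andP[m_i m_j] m_l /andP[/andP[p_i p_j] p_l] m_p.
  have j_m : j != m by rewrite eq_sym.
  have l_m : l != m by rewrite eq_sym.
  have l_j : l != j by rewrite eq_sym.
  have j_p : j != p by rewrite eq_sym.
  have i_p : i != p by rewrite eq_sym.
  have i_m : i != m by rewrite eq_sym.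
  have l_p : l != p by rewrite eq_sym.
  have ij_lm : e (G i j) (G l m).
    by apply: G_adj; rewrite /= !inE !negb_or i_j i_l i_m j_l j_m l_m.
  have lm_jp : e (G l m) (G j p).
    by apply: G_adj; rewrite /= !inE !negb_or l_m l_j l_p m_j m_p j_p.
  have il_jp : e (G i l) (G j p).
    by apply: G_adj; rewrite /= !inE !negb_or i_l i_j i_p l_j l_p j_p.
  by rewrite -G_eq in il_jp; exact: e_tri ij_lm lm_jp il_jp.
have disjoint_pairs (i j k l : 'I_5) : i != j -> k != l ->
    [disjoint [set i; j] & [set k; l]] = uniq [:: i; j; k; l].
  move=> i_j k_l; rewrite disjoints_subset subUset !sub1set !inE /= !inE.
  by rewrite !negb_or i_j k_l !andbT.
have g_hom A B : petersen A B -> e (g A) (g B).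
  have [i [j [i_j A_ij ->]]] := gE A; have [k [l [k_l B_kl ->]]] := gE B.
  by rewrite /petersen A_ij B_kl disjoint_pairs //; exact: G_adj.
have g_inj : injective g.
  move=> A B gAB; apply: val_inj; move: (g_hom A B) gAB; rewrite /petersen.
  have [i [j [i_j -> ->]]] := gE A; have [k [l [k_l -> ->]]] := gE B.
  move=> ij_kl G_eq; move: ij_kl; rewrite disjoint_pairs // G_eq e_irr.
  have l_k : l != k by rewrite eq_sym.
  have j_i : j != i by rewrite eq_sym.
  rewrite /= !inE !negb_or i_j k_l !andbT /=.
  have [i_k _|/= _] := eqVneq i k.
    by rewrite -i_k in k_l G_eq *; rewrite (G_inj_r i j l).
  have [i_l _|/= _] := eqVneq i l.
    rewrite -i_l in l_k G_eq *; rewrite (G_inj_r i j k) ?(GC i k) //.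
    by rewrite setUC.
  have [j_k _|/= _] := eqVneq j k.
    rewrite -j_k in k_l G_eq *; rewrite (G_inj_r j i l) ?(GC j i) //.
    by rewrite setUC.
  have [j_l _|/= _ /(_ isT) //] := eqVneq j l.
  rewrite -j_l in l_k G_eq *; rewrite (G_inj_r j i k) // GC G_eq; exact: GC.
exact: (regular_embedding_iso petersen_vertex_inhabited g_inj g_hom
         petersen_cubic e_cubic).
Qed.

(** * The characterisation *)

Unset Implicit Arguments.

Theorem theorem1p3 (R : realType) (n : nat) (e : rel 'I_n)
    (e_sym : symmetric e) (e_irr : irreflexive e)
    (e_conn : connected_graph e)
    (noC3 : ~ contains_subgraph (@cycle_graph 3) e)
    (noC4 : ~ contains_subgraph (@cycle_graph 4) e) :
  (exists l1 l2 l3 : R,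
      three_distinct_eigenvalues (distance_matrix R e) l1 l2 l3 /\ l3 = -3)
  <-> graph_iso e petersen.
Proof.
have e_tri := not_contains_cycle3 e_sym e_irr noC3.
have e_sq := not_contains_cycle4 e_sym e_irr noC4.
split=> [[l1 [l2 [l3 [[l21 l32 spec] l3E]]]]|[f f_bij f_adj]].
  have e_diam : diameter_le2 e.
    apply: (@diameter_le2_of_eigenvalue_ge R) => // a; rewrite spec !inE.
    by case/or3P=> /eqP ->; lra.
  have eig3 : eigenvalue (distance_matrix R e) (-3).
    by rewrite spec -l3E !inE eqxx !orbT.
  have [[k e_reg]|[c c_star]] :=
    regular_or_star R e_sym e_irr e_tri e_sq e_diam.
    have k3 := regular_degree3 e_sym e_irr e_tri e_sq e_diam e_reg eig3.
    rewrite {}k3 in e_reg.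
    have [G [GC G_adj]] := petersen_labelling e_sym e_tri e_sq e_diam e_reg
                             (Ordinal (eigenvalue_size_gt0 eig3)).
    exact: petersen_of_labelling GC G_adj.
  by have /negP := star_not_eigenvalue R e_sym e_irr e_tri e_diam c_star.
have e_diam : diameter_le2 e.
  exact: graph_iso_diameter_le2 f_bij f_adj petersen_diameter.
have e_reg x : #|e x| = 3%N.
  by rewrite (graph_iso_card f_bij f_adj) petersen_cubic.
have n_ge3 : (3 <= n)%N.
  have [g _ _] := f_bij; have x := g petersen_vertex_inhabited.
  by rewrite -(e_reg x) -[leqRHS]card_ord max_card.
have n_ge3R : 3 <= n%:R :> R by rewrite ler_nat.
exists (2 * n%:R - 5), 0, (-3); split=> //; split=> [||a]; [lra|lra|].
have n_gt0 : (0 < n)%N by exact: leq_trans n_ge3.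
exact: (cubic_eigenvalueE e_sym e_irr e_tri e_sq e_diam e_reg).
Qed.
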